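(* Let $F$ be a graph, let $p\ge 2$ and $m$ be positive integers. (1) Suppose that for every $n\ge m$, $S_{n,p}$ is (up to isomorphism) the unique $F$-free graph of order $n$ with $\mathrm{ex}(n,F)$ edges, i.e. $\mathrm{Ex}(n,F)=\{S_{n,p}\}$. Then for every $n\ge \max\{2^{4p},m^2\}$, $S_{n,p}$ is the unique $F$-free graph of order $n$ with maximum spectral radius, i.e. $\mathrm{Ex}_{sp}(n,F)=\{S_{n,p}\}$. (2) Suppose that for every $n\ge m$, $\mathrm{Ex}(n,F)=\{S^{+}_{n,p}\}$. Then for every $n\ge \max\{2^{4p},m^2\}$, $\mathrm{Ex}_{sp}(n,F)=\{S^{+}_{n,p}\}$.
   Context: All graphs are finite, simple, undirected. The spectral radius $\rho(G)$ is the largest eigenvalue of the adjacency matrix of $G$. A graph is $F$-free if it contains no subgraph isomorphic to $F$. $\mathrm{ex}(n,F)$ is the maximum number of edges of an $F$-free graph of order $n$, and $\mathrm{Ex}(n,F)$ is the set of $F$-free graphs of order $n$ with $\mathrm{ex}(n,F)$ edges. $\mathrm{Ex}_{sp}(n,F)$ is the set of $F$-free graphs of order $n$ having maximum spectral radius among all $F$-free graphs of order $n$. $S_{n,h}=K_h\vee \overline{K}_{n-h}$ (a clique of order $h$ joined to every vertex of an independent set of order $n-h$), and $S^{+}_{n,h}=K_h\vee(K_2\cup\overline{K}_{n-h-2})$ is $S_{n,h}$ with one edge added inside the independent set. $G\vee H$ denotes the join and $G\cup H$ the vertex-disjoint union. *)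

(* Defs.v *)
From HB Require Import structures.
From mathcomp Require Import all_boot all_order all_algebra all_fingroup.
From mathcomp Require Import classical_sets reals.
Set Implicit Arguments. Unset Strict Implicit. Unset Printing Implicit Defensive.
Import Order.TTheory GRing.Theory Num.Theory.

Definition sgraph (V : finType) (G : rel V) : Prop :=
  symmetric G /\ irreflexive G.

Definition nedges (V : finType) (G : rel V) : nat :=
  (#|[set e : V * V | G e.1 e.2]|)./2.

Definition contains (V : finType) (G : rel V) (k : nat) (F : rel 'I_k) : Prop :=
  exists f : 'I_k -> V, injective f /\ forall u v, F u v -> G (f u) (f v).

Definition Ffree (V : finType) (G : rel V) (k : nat) (F : rel 'I_k) : Prop :=
  ~ contains G F.

Definition giso (V : finType) (G H : rel V) : Prop :=
  exists s : {perm V}, forall x y, G x y = H (s x) (s y).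

Definition adjmx (R : realType) (n : nat) (G : rel 'I_n) : 'M[R]_n :=
  (\matrix_(i, j) (G i j)%:R)%R.

Local Open Scope classical_set_scope.
Definition spec_radius (R : realType) (n : nat) (G : rel 'I_n) : R :=
  sup [set a : R | eigenvalue (adjmx R G) a].
Local Close Scope classical_set_scope.

Definition in_Ex (n k : nat) (F : rel 'I_k) (G : rel 'I_n) : Prop :=
  sgraph G /\ Ffree G F /\
  forall H : rel 'I_n, sgraph H -> Ffree H F -> nedges H <= nedges G.

Definition in_Exsp (R : realType) (n k : nat) (F : rel 'I_k) (G : rel 'I_n) : Prop :=
  sgraph G /\ Ffree G F /\
  forall H : rel 'I_n, sgraph H -> Ffree H F ->
    (spec_radius R H <= spec_radius R G)%R.

(* S_{n,h} = K_h join complement of K_{n-h}: vertices 0..h-1 form the clique. *)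
Definition Snh (n h : nat) : rel 'I_n :=
  fun i j => (i != j) && ((i < h) || (j < h)).

Arguments Snh n h _ _ : clear implicits.

Definition Snh_plus (n h : nat) : rel 'I_n :=
  fun i j => Snh n h i j ||
    (((i : nat) == h) && ((j : nat) == h.+1)) ||
    (((i : nat) == h.+1) && ((j : nat) == h)).
Arguments Snh_plus n h _ _ : clear implicits.

(* Main.v *)
Require Import Defs.
From mathcomp Require Import all_boot all_order all_algebra all_fingroup.
From mathcomp Require Import classical_sets reals.
From mathcomp Require Import boolp topology normedtype derive ring lra zify.
Set Implicit Arguments. Unset Strict Implicit. Unset Printing Implicit Defensive.
Import Order.TTheory GRing.Theory Num.Theory numFieldNormedType.Exports.

(* Write l = rho(G), N = |G| - p, and let the surplus of G be
   l^2 - (p - 1) l - p N; it vanishes for S_{n,p} and equals 2p / (l - 1) for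
   S^+_{n,p}. If all degrees are at least p, averaging the row sums of
   A^2 - (p - 1) A with the Perron vector bounds the surplus by
   2 e(G) - 2 e(S_{n,p}), so a spectrally extremal G with minimum degree >= p is
   edge-extremal. If some degree is less than p, the smallest Perron entry is so
   small that removing its vertex raises the surplus: to at least 1/2 after one
   removal and at least 1 after two. The removals cannot stop at a graph of
   order h >= sqrt n with minimum degree >= p, whose surplus would contradict
   the edge-extremality of S_{h,p} or S^+_{h,p}. But they cannot go on down to
   order about sqrt n either: l^(4p-2) / N^(2p-2) does not decrease, which for
   n >= 2^(4p) violates l^2 <= 2 e(G). *)

Local Open Scope ring_scope.

(** * Perron vectors *)

(** Coordinate i of A x, with A the adjacency matrix. Vectors are plain functions, so deleting or
    permuting vertices is composition with [lift u] or with a permutation. *)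
Definition nbsum (R : realType) (n : nat) (G : rel 'I_n) (x : 'I_n -> R) i : R :=
  \sum_j (G i j)%:R * x j.

Definition sqnorm (R : realType) (n : nat) (x : 'I_n -> R) : R :=
  \sum_i x i ^+ 2.

Definition qform (R : realType) (n : nat) (G : rel 'I_n) (x : 'I_n -> R) : R :=
  \sum_i x i * nbsum G x i.

Lemma nbsumC (R : realType) (n : nat) (G : rel 'I_n) (x y : 'I_n -> R) :
  symmetric G -> \sum_i x i * nbsum G y i = \sum_i y i * nbsum G x i.
Proof.
move=> symG; under eq_bigr do rewrite mulr_sumr.
rewrite exchange_big /=; apply: eq_bigr => j _; rewrite mulr_sumr.
by apply: eq_bigr => i _; rewrite symG; ring.
Qed.

Lemma sqnorm_ge0 (R : realType) (n : nat) (x : 'I_n -> R) : 0 <= sqnorm x.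
Proof. by apply: sumr_ge0 => i _; rewrite sqr_ge0. Qed.

Lemma sqnorm_eq0 (R : realType) (n : nat) (x : 'I_n -> R) :
  sqnorm x = 0 -> forall i, x i = 0.
Proof.
move=> /psumr_eq0P x0 i; apply/eqP; rewrite -sqrf_eq0 x0 // => j _.
by rewrite sqr_ge0.
Qed.

Lemma qformZ (R : realType) (n : nat) (G : rel 'I_n) (c : R) x :
  qform G (fun i => c * x i) = c ^+ 2 * qform G x.
Proof.
rewrite /qform mulr_sumr; apply: eq_bigr => i _.
rewrite [in RHS]/nbsum !mulr_sumr; apply: eq_bigr => j _; ring.
Qed.

Lemma sqnormZ (R : realType) (n : nat) (c : R) (x : 'I_n -> R) :
  sqnorm (fun i => c * x i) = c ^+ 2 * sqnorm x.
Proof. by rewrite /sqnorm mulr_sumr; apply: eq_bigr => i _; rewrite exprMn. Qed.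

Lemma qformD (R : realType) (n : nat) (G : rel 'I_n) (x z : 'I_n -> R) (s : R) :
  symmetric G ->
  qform G (fun i => x i + s * z i) =
  qform G x + 2 * s * (\sum_i z i * nbsum G x i) + s ^+ 2 * qform G z.
Proof.
move=> symG.
have nbD i : nbsum G (fun i => x i + s * z i) i = nbsum G x i + s * nbsum G z i.
  rewrite /nbsum mulr_sumr -big_split /=; apply: eq_bigr => j _; ring.
rewrite /qform; under eq_bigr do rewrite nbD.
rewrite (_ : \sum_i _ = \sum_i (x i * nbsum G x i) +
   s * \sum_i (x i * nbsum G z i) + s * (\sum_i z i * nbsum G x i) +
   s ^+ 2 * (\sum_i z i * nbsum G z i)).
  by rewrite (nbsumC x z symG); ring.
by rewrite !mulr_sumr -!big_split; apply: eq_bigr => i _ /=; ring.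
Qed.

Lemma sqnormD (R : realType) (n : nat) (x z : 'I_n -> R) (s : R) :
  sqnorm (fun i => x i + s * z i) =
  sqnorm x + 2 * s * (\sum_i z i * x i) + s ^+ 2 * sqnorm z.
Proof.
rewrite /sqnorm !mulr_sumr -!big_split; apply: eq_bigr => i _ /=; ring.
Qed.

(** For small positive s the linear term outweighs the quadratic one: a positive e would make the
    value negative at s = e / (b + 1). *)
Lemma quadratic_ge0_linear_eq0 (R : realType) (e b : R) :
  0 <= e -> (forall s, 0 <= s ^+ 2 * b - 2 * s * e) -> e = 0.
Proof.
move=> e0 H; apply/eqP; rewrite -[_ == _]negbK; apply/negP => en0.
have {e0 en0}e0 : 0 < e by rewrite lt_neqAle eq_sym en0.
have b0 : 0 <= b by have := H (-1); have := H 1; lra.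
have b1 : 0 < b + 1 by lra.
have := H (e / (b + 1)).
rewrite (_ : _ - _ = - (e / (b + 1)) ^+ 2 * (b + 2)); last by field; lra.
rewrite leNgt mulNr oppr_lt0 mulr_gt0 // ?exprn_gt0 ?divr_gt0 //; lra.
Qed.

Local Open Scope classical_set_scope.

Lemma continuous_sum (T : topologicalType) (R : realType) (I : finType)
    (f : I -> T -> R) :
  (forall i, continuous (f i)) -> continuous (fun x => \sum_i f i x).
Proof.
move=> cf; have addc := @add_continuous R^o.
by apply: (continuous_big addc) => i _; exact: cf.
Qed.

(** The unit sphere is compact and the quadratic form continuous; functions are read as row vectors,
    which carry the topology. *)
Lemma qform_sphere_max (R : realType) (n : nat) (G : rel 'I_n) :
  (0 < n)%N -> exists x : 'I_n -> R,
    sqnorm x = 1 /\ forall y, sqnorm y = 1 -> qform G y <= qform G x.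
Proof.
move=> n0.
pose v2f (v : 'rV[R]_n) := fun i => v ord0 i.
have coordc i : continuous (fun v : 'rV[R]_n => v2f v i).
  exact: coord_continuous.
have sqc : continuous (fun v => sqnorm (v2f v)).
  apply: continuous_sum => i v.
  by apply: (@continuousM _ _ (v2f^~ i) (v2f^~ i)); exact: coordc.
have qc : continuous (fun v => qform G (v2f v)).
  apply: continuous_sum => i v.
  apply: (@continuousM _ _ (v2f^~ i) (fun v => nbsum G (v2f v) i)).
    exact: coordc.
  move: v; apply: continuous_sum => j v.
  apply: (@continuousM _ _ (fun=> (G i j)%:R) (v2f^~ j)); last exact: coordc.
  exact: cst_continuous.
pose A := [set v : 'rV[R]_n | sqnorm (v2f v) = 1].
have A0 : A !=set0.
  exists (\row_j (j == Ordinal n0)%:R); rewrite /A /= /sqnorm /v2f.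
  rewrite (bigD1 (Ordinal n0)) //= mxE eqxx expr1n big1 ?addr0 // => i /negbTE.
  by rewrite mxE => ->; rewrite expr0n.
have Acl : closed A.
  apply: (@closed_comp _ _ (fun v => sqnorm (v2f v)) [set x | x = 1]).
    by move=> v _; exact: sqc.
  exact: closed_eq.
(* The matrix norm is the largest absolute value of an entry, and each squared entry is at most the
   sum of squares, here 1. *)
have Abd : bounded_set A.
  exists 1; split; first exact: num_real.
  move=> M M1 v Av /=; apply: (le_trans _ (ltW M1)).
  rewrite [leLHS]/Num.norm /= mx_normrE; apply: bigmax_le => // -[i j] _ /=.
  rewrite ord1 -(@ler_pXn2r _ 2) ?nnegrE // expr1n real_normK ?num_real //.
  rewrite -Av /sqnorm (bigD1 j) //= lerDl; apply: sumr_ge0 => k _.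
  exact: sqr_ge0.
have [|c] := @EVT_max_rV R n (fun v => qform G (v2f v)) A A0
  (bounded_closed_compact Abd Acl).
  exact: continuous_subspaceT.
rewrite inE => Ac cmax; exists (v2f c); split=> // y y1.
have Ey : v2f (\row_j y j) = y by apply: funext => i; rewrite /v2f mxE.
by rewrite -Ey; apply: cmax; rewrite inE /A /= Ey.
Qed.

Local Close Scope classical_set_scope.

(** Perturb x along the residual r = A x - M x. The nonnegative gap M |y|^2 - y^T A y vanishes at y
    = x, and at y = x + s r its linear term in s is -2 s |r|^2, which forces r = 0. *)
Lemma qform_max_eigen (R : realType) (n : nat) (G : rel 'I_n) (x : 'I_n -> R) (M : R) :
  symmetric G -> (forall y, qform G y <= M * sqnorm y) ->
  qform G x = M * sqnorm x -> forall i, nbsum G x i = M * x i.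
Proof.
move=> symG maxM xM i.
pose r i := nbsum G x i - M * x i.
have Er : sqnorm r = \sum_i (r i * nbsum G x i) - M * \sum_i r i * x i.
  by rewrite mulr_sumr -sumrB; apply: eq_bigr => j _; rewrite /r; ring.
apply/eqP; rewrite -subr_eq0; apply/eqP; apply: (@sqnorm_eq0 _ _ r _ i).
apply: (@quadratic_ge0_linear_eq0 _ _ (M * sqnorm r - qform G r)).
  exact: sqnorm_ge0.
move=> s; have := maxM (fun i => x i + s * r i).
rewrite qformD // sqnormD xM {3}Er; lra.
Qed.

(** Identifies the supremum in [spec_radius]: M is an eigenvalue, and the Rayleigh bound keeps every
    eigenvalue at most M. Symmetry reconciles [nbsum] with the row-vector convention of
    [eigenvalue]. *)
Lemma spec_radius_max (R : realType) (n : nat) (G : rel 'I_n) (x : 'I_n -> R) (M : R) :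
  symmetric G -> sqnorm x = 1 -> (forall i, nbsum G x i = M * x i) ->
  (forall y, qform G y <= M * sqnorm y) -> spec_radius R G = M.
Proof.
move=> symG x1 eigx maxM; rewrite /spec_radius.
have rowE (v : 'rV[R]_n) i : (v *m adjmx R G) ord0 i = nbsum G (v ord0) i.
  rewrite mxE /nbsum; apply: eq_bigr => j _; rewrite mxE symG; ring.
have eigM : eigenvalue (adjmx R G) M.
  apply/eigenvalueP; exists (\row_i x i).
    apply/rowP => i; rewrite rowE !mxE -eigx /nbsum.
    by apply: eq_bigr => j _; rewrite mxE.
  apply/eqP => /rowP x0; move: x1; rewrite /sqnorm big1.
    by move/eqP; rewrite eq_sym oner_eq0.
  by move=> i _; have := x0 i; rewrite !mxE => ->; rewrite expr0n.
have leM a : eigenvalue (adjmx R G) a -> a <= M.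
  move=> /eigenvalueP [v va v0].
  have := maxM (v ord0); rewrite (_ : qform G _ = a * sqnorm (v ord0)).
    rewrite ler_pM2r // lt_neqAle sqnorm_ge0 andbT eq_sym.
    apply: contra v0 => /eqP /sqnorm_eq0 v0; apply/eqP/rowP => i.
    by rewrite v0 mxE.
  rewrite /qform /sqnorm mulr_sumr; apply: eq_bigr => i _.
  by rewrite -rowE va mxE; ring.
apply/le_anti/andP; split; first by apply: sup_le_ub; first exists M.
by apply: ub_le_sup => //; exists M.
Qed.

(** Replacing the entries of a maximiser by their absolute values cannot lower the quadratic form,
    as A is nonnegative; the result is again a maximiser, hence an eigenvector. Entries may vanish,
    since G may be disconnected. *)
Lemma perron (R : realType) (n : nat) (G : rel 'I_n) :
  (0 < n)%N -> symmetric G ->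
  exists x : 'I_n -> R, [/\ forall i, 0 <= x i, sqnorm x = 1,
    forall i, nbsum G x i = spec_radius R G * x i &
    forall y, qform G y <= spec_radius R G * sqnorm y].
Proof.
move=> n0 symG; have [x [x1 xmax]] := qform_sphere_max R G n0.
pose M := qform G x.
have maxM y : qform G y <= M * sqnorm y.
  have [y0|yn0] := eqVneq (sqnorm y) 0.
    rewrite y0 mulr0 /qform big1 // => i _.
    by rewrite (sqnorm_eq0 y0) mul0r.
  have ypos : 0 < sqnorm y by rewrite lt_neqAle eq_sym yn0 sqnorm_ge0.
  pose c := (Num.sqrt (sqnorm y))^-1.
  have c2 : c ^+ 2 = (sqnorm y)^-1 by rewrite exprVn sqr_sqrtr // ltW.
  have := xmax (fun i => c * y i); rewrite sqnormZ qformZ c2 mulVf // => /(_ erefl).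
  by rewrite mulrC ler_pdivrMr.
pose z i := `|x i|.
have z1 : sqnorm z = 1.
  by rewrite -x1; apply: eq_bigr => i _; rewrite real_normK ?num_real.
have zM : qform G z = M * sqnorm z.
  apply/le_anti; rewrite maxM z1 mulr1 /M /qform /=.
  apply: ler_sum => i _; rewrite !mulr_sumr; apply: ler_sum => j _.
  apply: le_trans (ler_norm _) _; rewrite !normrM /z.
  by rewrite (ger0_norm (ler0n _ _)).
have eigz := qform_max_eigen symG maxM zM.
have -> := spec_radius_max symG z1 eigz maxM.
by exists z; split=> // i; exact: normr_ge0.
Qed.

(** * Degrees and the spectral radius *)

Definition degree (n : nat) (G : rel 'I_n) (i : 'I_n) : nat := (\sum_j G i j)%N.

(** Ordered adjacent pairs: 2 e(G) for a simple graph, without the halving in [nedges]. *)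
Definition narcs (n : nat) (G : rel 'I_n) : nat := (\sum_i degree G i)%N.

Lemma degreeE (R : realType) (n : nat) (G : rel 'I_n) i :
  (degree G i)%:R = nbsum G (fun=> 1 : R) i.
Proof.
by rewrite /degree natr_sum /nbsum; apply: eq_bigr => j _; rewrite mulr1.
Qed.

Lemma narcsE (R : realType) (n : nat) (G : rel 'I_n) :
  (narcs G)%:R = \sum_i nbsum G (fun=> 1 : R) i.
Proof. by rewrite /narcs natr_sum; apply: eq_bigr => i _; rewrite degreeE. Qed.

Lemma sum_nbsum (R : realType) (n : nat) (G : rel 'I_n) (x : 'I_n -> R) :
  symmetric G -> \sum_i nbsum G x i = \sum_i x i * nbsum G (fun=> 1) i.
Proof.
by move=> symG; rewrite -nbsumC //; apply: eq_bigr => i _; rewrite mul1r.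
Qed.

Lemma card_arcs (n : nat) (G : rel 'I_n) :
  #|[set e : 'I_n * 'I_n | G e.1 e.2]| = narcs G.
Proof.
rewrite -sum1_card big_mkcond /narcs /degree /= pair_big /=.
by apply: eq_bigr => -[i j] _; rewrite inE /=; case: (G i j).
Qed.

(** Transposition matches the arcs below the diagonal with those above it and there are no loops, so
    the halving in [nedges] is exact. *)
Lemma double_nedges (n : nat) (G : rel 'I_n) :
  sgraph G -> (2 * nedges G = narcs G)%N.
Proof.
move=> [symG irrG]; rewrite /nedges card_arcs.
have E : narcs G = (\sum_(i < n) \sum_(j < n | (j < i)%N) G i j).*2.
  have -> : narcs G = (\sum_(i < n) \sum_(j < n | (j < i)%N) G i j +
                       \sum_(i < n) \sum_(j < n | (i < j)%N) G i j)%N.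
    rewrite /narcs /degree -big_split; apply: eq_bigr => i _ /=.
    rewrite (bigID (fun j : 'I_n => (j < i)%N)) /=; congr addn.
    rewrite (bigD1 i) ?ltnn //= irrG add0n; apply: eq_bigl => j.
    by rewrite -leqNgt ltn_neqAle eq_sym andbC.
  rewrite -addnn; congr addn.
  rewrite [RHS](exchange_big_dep predT) //=; apply: eq_bigr => i _.
  by apply: eq_bigr => j _; rewrite symG.
by rewrite E doubleK mul2n.
Qed.

Lemma sum_gt0_sqnorm1 (R : realType) (n : nat) (x : 'I_n -> R) :
  (forall i, 0 <= x i) -> sqnorm x = 1 -> 0 < \sum_i x i.
Proof.
move=> x0 x1; rewrite lt_neqAle sumr_ge0 // andbT eq_sym.
apply/negP => /eqP /psumr_eq0P x00; move: x1; rewrite /sqnorm big1.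
  by move/eqP; rewrite eq_sym oner_eq0.
by move=> i _; rewrite x00 ?expr0n // => j _; exact: x0.
Qed.

Lemma spec_radius_ge0 (R : realType) (n : nat) (G : rel 'I_n) :
  (0 < n)%N -> symmetric G -> 0 <= spec_radius R G.
Proof.
move=> n0 symG; have [x [x0 x1 eigx _]] := perron R n0 symG.
have T0 := sum_gt0_sqnorm1 x0 x1.
rewrite -(pmulr_lge0 _ T0) mulr_sumr; apply: sumr_ge0 => i _.
rewrite -eigx; apply: sumr_ge0 => j _; exact: mulr_ge0.
Qed.

(** The sum of (s - x_j)^2 over the neighbours j of i is nonnegative; take s to be the mean of x
    over them. *)
Lemma cauchy_schwarz_nbsum (R : realType) (n : nat) (G : rel 'I_n)
    (x : 'I_n -> R) i :
  nbsum G x i ^+ 2 <= (degree G i)%:R * \sum_j (G i j)%:R * x j ^+ 2.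
Proof.
have H s : 0 <= s ^+ 2 * (degree G i)%:R - 2 * s * nbsum G x i +
    \sum_j (G i j)%:R * x j ^+ 2.
  have -> : s ^+ 2 * (degree G i)%:R - 2 * s * nbsum G x i +
    \sum_j (G i j)%:R * x j ^+ 2 = \sum_j (G i j)%:R * (s - x j) ^+ 2.
    rewrite degreeE /nbsum !mulr_sumr -sumrB -big_split /=.
    by apply: eq_bigr => j _; ring.
  by apply: sumr_ge0 => j _; rewrite mulr_ge0 // sqr_ge0.
have [d0|dn0] := eqVneq (degree G i) 0%N.
  rewrite /nbsum big1 ?expr0n ?d0 ?mul0r // => j _.
  move: d0; rewrite /degree => /eqP; rewrite sum_nat_eq0 => /forallP /(_ j) /=.
  by move/eqP => ->; rewrite mul0r.
have dp : 0 < (degree G i)%:R :> R by rewrite ltr0n lt0n.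
have := H (nbsum G x i / (degree G i)%:R).
set d : R := (degree G i)%:R in dp *; set q := \sum_j _; set b := nbsum G x i.
rewrite (_ : _ + q = (d * q - b ^+ 2) / d); last by field; lra.
by rewrite pmulr_lge0 ?invr_gt0 // subr_ge0.
Qed.

(** By Cauchy-Schwarz each l^2 x_i^2 is at most the degree of i; sum over i. *)
Lemma sqr_spec_radius_le (R : realType) (n : nat) (G : rel 'I_n) :
  (0 < n)%N -> symmetric G -> spec_radius R G ^+ 2 <= (narcs G)%:R.
Proof.
move=> n0 symG; have [x [x0 x1 eigx _]] := perron R n0 symG.
have -> : spec_radius R G ^+ 2 = \sum_i spec_radius R G ^+ 2 * x i ^+ 2.
  by rewrite -mulr_sumr -/(sqnorm x) x1 mulr1.
rewrite /narcs natr_sum; apply: ler_sum => i _.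
rewrite -exprMn -eigx; apply: le_trans (cauchy_schwarz_nbsum _ _ _) _.
rewrite ler_piMr // -[in leRHS]x1; apply: ler_sum => j _.
by rewrite ler_piMl ?sqr_ge0 // lern1 leq_b1.
Qed.

(** Summing the eigenvalue equations turns l times the sum of the x_i into the sum of the d_i
    x_i. *)
Lemma spec_radius_ge_degree (R : realType) (n p : nat) (G : rel 'I_n) :
  (0 < n)%N -> symmetric G -> (forall i, (p <= degree G i)%N) ->
  p%:R <= spec_radius R G.
Proof.
move=> n0 symG dG; have [x [x0 x1 eigx _]] := perron R n0 symG.
have T0 := sum_gt0_sqnorm1 x0 x1.
rewrite -(ler_pM2r T0) [leRHS]mulr_sumr; under [leRHS]eq_bigr do rewrite -eigx.
rewrite sum_nbsum // mulr_sumr; apply: ler_sum => i _.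
by rewrite -degreeE mulrC ler_wpM2l // ler_nat.
Qed.

(* The eigenvector averages the row sums of A^2 - (p - 1) A, each of which is
   at most 2 e(G) - (n - 1) p because non-neighbours have degree >= p. *)
Lemma spec_radius_min_degree (R : realType) (n p : nat) (G : rel 'I_n) :
  (0 < n)%N -> sgraph G -> (forall i, (p <= degree G i)%N) ->
  spec_radius R G ^+ 2 - (p%:R - 1) * spec_radius R G
    <= (narcs G)%:R - (n%:R - 1) * p%:R.
Proof.
move=> n0 [symG irrG] dG; have [x [x0 x1 eigx _]] := perron R n0 symG.
set l := spec_radius R G in eigx *.
have T0 := sum_gt0_sqnorm1 x0 x1.
pose d i : R := nbsum G (fun=> 1) i.
have dp i : p%:R <= d i by rewrite /d -degreeE ler_nat.
have E1 : l * (\sum_i x i) = \sum_i x i * d i.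
  rewrite mulr_sumr; under eq_bigr do rewrite -eigx.
  exact: sum_nbsum.
have E2 : l * (\sum_i x i * d i) = \sum_i x i * nbsum G d i.
  rewrite [RHS]nbsumC // mulr_sumr; apply: eq_bigr => i _; rewrite eigx; ring.
rewrite -(ler_pM2r T0).
rewrite (_ : _ * _ = \sum_i x i * (nbsum G d i - (p%:R - 1) * d i)).
  rewrite mulr_sumr; apply: ler_sum => i _; rewrite mulrC ler_wpM2r //.
  (* The right side sums the degrees of the n - d_i vertices not adjacent to i. Each is at least p,
     and i itself, being one of them, contributes d_i instead of p. *)
  suff H : p%:R * (n%:R - d i) + (d i - p%:R) <= (narcs G)%:R - nbsum G d i by lra.
  have -> : (narcs G)%:R - nbsum G d i = \sum_j (1 - (G i j)%:R) * d j.
    rewrite narcsE [nbsum G d i]/nbsum -sumrB; apply: eq_bigr => j _.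
    by rewrite -/(d j); ring.
  have -> : p%:R * (n%:R - d i) = \sum_j (1 - (G i j)%:R) * p%:R.
    rewrite -mulr_suml sumrB sumr_const card_ord /d /nbsum mulrC.
    by under [in RHS]eq_bigr do rewrite -[_%:R]mulr1.
  rewrite -lerBrDl -sumrB (bigD1 i) //= irrG subr0 !mul1r lerDl.
  apply: sumr_ge0 => j _; rewrite -mulrBr mulr_ge0 ?subr_ge0 //.
  by rewrite lern1 leq_b1.
set T := \sum_i x i in E1 T0 *.
have -> : (l ^+ 2 - (p%:R - 1) * l) * T = l * (l * T) - (p%:R - 1) * (l * T).
  by ring.
rewrite E1 E2 mulr_sumr -sumrB.
by apply: eq_bigr => i _; ring.
Qed.

(** * Vertex deletion *)

Definition vdel (n : nat) (G : rel 'I_n.+1) (u : 'I_n.+1) : rel 'I_n :=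
  fun i j => G (lift u i) (lift u j).

Lemma sgraph_vdel (n : nat) (G : rel 'I_n.+1) u : sgraph G -> sgraph (vdel G u).
Proof. by move=> [symG irrG]; split=> [i j|i]; [exact: symG|exact: irrG]. Qed.

Lemma Ffree_vdel (n k : nat) (G : rel 'I_n.+1) u (F : rel 'I_k) :
  Ffree G F -> Ffree (vdel G u) F.
Proof.
move=> GF [f [finj fG]]; apply: GF; exists (lift u \o f); split.
  by apply: inj_comp finj; exact: lift_inj.
by move=> a b /fG.
Qed.

Lemma qform_vdel (R : realType) (n : nat) (G : rel 'I_n.+1) (x : 'I_n.+1 -> R) u :
  sgraph G ->
  qform (vdel G u) (x \o lift u) = qform G x - 2 * x u * nbsum G x u.
Proof.
move=> [symG irrG].
have nbE i : nbsum (vdel G u) (x \o lift u) i =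
    nbsum G x (lift u i) - (G u (lift u i))%:R * x u.
  rewrite [nbsum G _ _](_ : _ = (G u (lift u i))%:R * x u +
    nbsum (vdel G u) (x \o lift u) i); first by ring.
  by rewrite {1}/nbsum (bigD1_ord u) //= symG.
rewrite /qform (bigD1_ord u) //=; under eq_bigr do rewrite nbE /= mulrBr.
rewrite sumrB.
have -> : \sum_i x (lift u i) * ((G u (lift u i))%:R * x u) = x u * nbsum G x u.
  rewrite [in RHS]/nbsum (bigD1_ord u) //= irrG mul0r add0r mulr_sumr.
  by apply: eq_bigr => i _; ring.
by ring.
Qed.

Lemma sqnorm_vdel (R : realType) (n : nat) (x : 'I_n.+1 -> R) u :
  sqnorm (x \o lift u) = sqnorm x - x u ^+ 2.
Proof. by rewrite /sqnorm [in RHS](bigD1_ord u) //=; ring. Qed.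

(** The Perron vector restricted to G - u is the test vector: losing u costs 2 l x_u^2 in the
    quadratic form and x_u^2 in the squared norm. *)
Lemma spec_radius_vdel (R : realType) (n : nat) (G : rel 'I_n.+1) (x : 'I_n.+1 -> R) u :
  (0 < n)%N -> sgraph G -> sqnorm x = 1 ->
  (forall i, nbsum G x i = spec_radius R G * x i) ->
  spec_radius R G * (1 - 2 * x u ^+ 2)
    <= spec_radius R (vdel G u) * (1 - x u ^+ 2).
Proof.
move=> n0 sG x1 eigx.
have [z [_ _ _ maxq]] := perron R n0 (sgraph_vdel u sG).1.
have := maxq (x \o lift u).
rewrite sqnorm_vdel x1 qform_vdel // eigx.
rewrite (_ : qform G x = spec_radius R G); first lra.
rewrite /qform -[RHS]mulr1 -x1 mulr_sumr.
by apply: eq_bigr => i _; rewrite eigx; ring.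
Qed.

(** Cauchy-Schwarz at v bounds l^2 x_v^2 by d times the squared weight of the d neighbours of v; the
    other n - d vertices each keep at least t of the total weight 1. *)
Lemma min_entry_bound (R : realType) (n : nat) (G : rel 'I_n) (x : 'I_n -> R)
    (l t : R) v :
  sqnorm x = 1 -> nbsum G x v = l * x v ->
  t <= x v ^+ 2 -> (forall i, t <= x i ^+ 2) ->
  l ^+ 2 * t <= (degree G v)%:R * (1 - (n%:R - (degree G v)%:R) * t).
Proof.
move=> x1 eigv tv tmin.
have H1 : l ^+ 2 * t <= nbsum G x v ^+ 2.
  by rewrite eigv exprMn ler_wpM2l ?sqr_ge0.
apply: le_trans H1 (le_trans (cauchy_schwarz_nbsum _ _ _) _).
rewrite ler_wpM2l // lerBrDr -[in leRHS]x1 -lerBrDl /sqnorm -sumrB.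
rewrite degreeE /nbsum (_ : n%:R = \sum_(i < n) 1); last first.
  by rewrite sumr_const card_ord.
rewrite -sumrB mulr_suml; apply: ler_sum => j _.
rewrite mulr1; case: (G v j) => /=.
  by rewrite mul1r !subrr mul0r.
by rewrite mul0r !subr0 mul1r.
Qed.

(* The vertex removed is one with smallest Perron entry; the vertex of low
   degree only certifies that this entry is small. *)
Lemma low_degree_deletion (R : realType) (n p : nat) (G : rel 'I_n.+1) v :
  (0 < n)%N -> (0 < p)%N -> sgraph G -> (degree G v < p)%N -> (p <= n.+1)%N ->
  exists u, exists e : R, [/\ 0 <= e,
    e * (spec_radius R G ^+ 2 + (p%:R - 1) * (n.+1%:R - p%:R)) <= p%:R - 1 &
    spec_radius R G * (1 - e) <= spec_radius R (vdel G u)].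
Proof.
move=> n0 p0 sG dv pn.
have [x [x0 x1 eigx _]] := perron R (ltn0Sn n) sG.1.
pose u := [arg min_(i < ord0) x i]%O.
have umin i : x u <= x i by rewrite /u; case: arg_minP => // j _ ->.
set t := x u ^+ 2; have t0 : 0 <= t := sqr_ge0 _.
have tmin i : t <= x i ^+ 2.
  by rewrite /t ler_pXn2r ?nnegrE.
have nt : n.+1%:R * t <= 1.
  rewrite -[in leRHS]x1 (_ : n.+1%:R * t = \sum_(i < n.+1) t); last first.
    by rewrite sumr_const card_ord mulr_natl.
  by apply: ler_sum => i _; exact: tmin.
have n1 : (1 : R) <= n%:R by rewrite ler1n.
have t12 : t <= 2^-1.
  have : 2 * t <= n.+1%:R * t by rewrite ler_wpM2r // ler_nat.
  lra.
have := min_entry_bound x1 (eigx v) (tmin v) tmin.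
set l := spec_radius R G in eigx *; set d : R := (degree G v)%:R => Ht.
have d0 : 0 <= d by rewrite ler0n.
have dp : d <= p%:R - 1 by rewrite lerBrDr -(natrD _ _ 1) ler_nat addn1.
have l0 : 0 <= l := spec_radius_ge0 R (ltn0Sn n) sG.1.
(* With this e the deletion bound l (1 - 2 t) / (1 - t) is exactly l (1 - e). *)
exists u, (t / (1 - t)).
have t1 : 0 < 1 - t by lra.
split.
- by rewrite divr_ge0 // ltW.
- rewrite mulrAC ler_pdivrMr //.
  set q := p%:R - 1 in dp *.
  (* The bound increases with d because (n + 1) t <= 1, so d may be raised to p - 1. *)
  have : d * (1 - (n.+1%:R - d) * t) <= q * (1 - (n.+1%:R - q) * t).
    have H1 : 0 <= (q - d) * (1 - n.+1%:R * t) by rewrite mulr_ge0; lra.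
    have H2 : 0 <= (q - d) * ((q + d) * t).
      by rewrite mulr_ge0 ?mulr_ge0 //; lra.
    lra.
  rewrite (_ : p%:R = q + 1); last by rewrite /q; ring.
  lra.
- have := spec_radius_vdel u n0 sG x1 eigx; rewrite -/t -/l => H.
  rewrite (_ : _ * _ = l * (1 - 2 * t) / (1 - t)); last by field; lra.
  by rewrite ler_pdivrMr.
Qed.

(** * The graphs S_{n,p} and S^+_{n,p} *)

Lemma giso_refl (n : nat) (G : rel 'I_n) : giso G G.
Proof. by exists 1%g => x y; rewrite !perm1. Qed.

Lemma sgraph_giso (n : nat) (G H : rel 'I_n) : giso G H -> sgraph H -> sgraph G.
Proof.
by move=> [s Gs] [symH irrH]; split=> [i j|i]; rewrite !Gs; [exact: symH|exact: irrH].
Qed.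

Lemma spec_radius_giso (R : realType) (n : nat) (G H : rel 'I_n) :
  (0 < n)%N -> sgraph H -> giso G H -> spec_radius R G = spec_radius R H.
Proof.
move=> n0 sH isoGH; have sG := sgraph_giso isoGH sH; case: isoGH => s Gs.
have [x [x0 x1 eigx maxx]] := perron R n0 sH.1.
have reix (f : 'I_n -> R) : \sum_i f (s i) = \sum_i f i.
  by rewrite [RHS](reindex_inj (@perm_inj _ s)).
have nbE (y : 'I_n -> R) i : nbsum G (y \o s) i = nbsum H y (s i).
  by rewrite /nbsum -[RHS]reix; apply: eq_bigr => j _; rewrite Gs.
apply: (@spec_radius_max _ _ _ (x \o s)) => [||i|y]; first exact: sG.1.
- by rewrite -x1 /sqnorm -[RHS]reix.
- by rewrite nbE eigx.
have Ey : y = (y \o (s^-1)%g) \o s by apply: funext => i /=; rewrite permK.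
rewrite Ey; move: (y \o _) => z.
have -> : qform G (z \o s) = qform H z.
  by rewrite /qform -[RHS]reix; apply: eq_bigr => i _; rewrite nbE.
have -> : sqnorm (z \o s) = sqnorm z by rewrite /sqnorm -[RHS]reix.
exact: maxx.
Qed.

Lemma sgraph_Snh (n p : nat) : sgraph (Snh n p).
Proof.
split=> [i j|i]; last by rewrite /Snh eqxx.
by rewrite /Snh eq_sym orbC.
Qed.

Lemma sgraph_Snh_plus (n p : nat) : sgraph (Snh_plus n p).
Proof.
split=> [i j|i]; rewrite /Snh_plus.
  rewrite (sgraph_Snh n p).1 -!orbA; congr orb; rewrite orbC.
  by congr orb; rewrite andbC.
rewrite (sgraph_Snh n p).2 /=; apply/negbTE; lia.
Qed.

Lemma nbsum_Snh (R : realType) (n p : nat) (x : 'I_n -> R) i :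
  nbsum (Snh n p) x i =
  if (i < p)%N then \sum_j x j - x i else \sum_(j < n | (j < p)%N) x j.
Proof.
rewrite /nbsum /Snh; case: ltnP => ip.
  rewrite (bigD1 i) //= eqxx mul0r add0r [in RHS](bigD1 i) //= addrC addrK.
  by apply: eq_bigr => j; rewrite eq_sym => ->; rewrite mul1r.
rewrite [RHS]big_mkcond; apply: eq_bigr => j _ /=.
case: ltnP => jp; last by rewrite andbF mul0r.
suff -> : i != j by rewrite mul1r.
by apply/eqP => ij; move: ip; rewrite ij leqNgt jp.
Qed.

Lemma nbsum_Snh_plus (R : realType) (n p : nat) (x : 'I_n -> R) (u v i : 'I_n) :
  u = p :> nat -> v = p.+1 :> nat ->
  nbsum (Snh_plus n p) x i =
  nbsum (Snh n p) x i + ((i == u)%:R * x v + (i == v)%:R * x u).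
Proof.
move=> up vp.
have pickE (w : 'I_n) : x w = \sum_j (j == w)%:R * x j.
  rewrite (bigD1 w) //= eqxx mul1r big1 ?addr0 // => j /negbTE ->.
  by rewrite mul0r.
rewrite [x v]pickE [x u]pickE !mulr_sumr -!big_split /=.
apply: eq_bigr => j _; rewrite !mulrA -!mulrDl; congr (_ * _).
rewrite -!natrM -!natrD; congr (_%:R).
rewrite /Snh_plus /Snh -!(inj_eq val_inj) /= up vp.
move: (i : nat) (j : nat) => a b.
case: (a =P p) => ?; case: (b =P p) => ?; case: (a =P p.+1) => ?;
  case: (b =P p.+1) => ?; case: (a =P b) => ?; case: (ltnP a p) => ?;
  case: (ltnP b p) => ? //=; lia.
Qed.

Lemma sum1_ltn (R : realType) (n p : nat) :
  (p <= n)%N -> \sum_(j < n | (j < p)%N) (1 : R) = p%:R.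
Proof.
by move=> pn; rewrite (big_ord_narrow pn) sumr_const card_ord.
Qed.

Lemma sum1_geq (R : realType) (n p : nat) :
  (p <= n)%N -> \sum_(j < n | ~~ (j < p)%N) (1 : R) = n%:R - p%:R.
Proof.
move=> pn; have : \sum_(j < n) (1 : R) = n%:R by rewrite sumr_const card_ord.
by rewrite (bigID (fun j : 'I_n => (j < p)%N)) /= sum1_ltn // => <-; ring.
Qed.

Lemma degree_Snh_ge (R : realType) (n p : nat) (i : 'I_n) :
  (p < n)%N -> p%:R <= nbsum (Snh n p) (fun=> 1 : R) i.
Proof.
move=> pn; rewrite nbsum_Snh sum1_ltn ?(ltnW pn) //; case: ifP => // _.
by rewrite sumr_const card_ord lerBrDr natr1 ler_nat.
Qed.

Lemma narcs_Snh (R : realType) (n p : nat) :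
  (p <= n)%N -> (narcs (Snh n p))%:R = 2 * p%:R * n%:R - p%:R * (p%:R + 1) :> R.
Proof.
move=> pn; rewrite narcsE; under eq_bigr do rewrite nbsum_Snh.
rewrite (bigID (fun i : 'I_n => (i < p)%N)) /=.
under eq_bigr => i -> do rewrite -[_ - _]mulr1.
under [X in _ + X]eq_bigr => i /negbTE -> do rewrite sum1_ltn // -[_%:R]mulr1.
rewrite -!mulr_sumr sum1_ltn // sum1_geq // sumr_const card_ord; ring.
Qed.

Lemma narcs_Snh_plus (R : realType) (n p : nat) :
  (p.+2 <= n)%N -> (narcs (Snh_plus n p))%:R = (narcs (Snh n p))%:R + 2 :> R.
Proof.
move=> pn.
pose u : 'I_n := Ordinal (ltnW pn); pose v : 'I_n := Ordinal pn.
rewrite !narcsE; under eq_bigr do rewrite (@nbsum_Snh_plus _ _ _ _ u v) // !mulr1.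
rewrite !big_split /=; congr (_ + _).
have pick (w : 'I_n) : \sum_i ((i == w)%:R : R) = 1.
  by rewrite (bigD1 w) //= eqxx big1 ?addr0 // => j /negbTE ->.
by rewrite !pick.
Qed.

Lemma spec_radius_Snh_ge (R : realType) (n p : nat) :
  (p < n)%N -> p%:R <= spec_radius R (Snh n p).
Proof.
move=> pn; apply: spec_radius_ge_degree (sgraph_Snh n p).1 _; first lia.
by move=> i; rewrite -(ler_nat R) degreeE degree_Snh_ge.
Qed.

Lemma spec_radius_Snh_plus_ge (R : realType) (n p : nat) :
  (p.+2 <= n)%N -> p%:R <= spec_radius R (Snh_plus n p).
Proof.
move=> pn; apply: spec_radius_ge_degree (sgraph_Snh_plus n p).1 _; first lia.
move=> i; rewrite -(ler_nat R) degreeE.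
rewrite (@nbsum_Snh_plus _ _ _ _ (Ordinal (ltnW pn)) (Ordinal pn)) //.
apply: le_trans (@degree_Snh_ge R n p i (ltnW pn)) _.
by rewrite lerDl addr_ge0 // mulr1.
Qed.

(** Treats both graphs at once: c is the contribution of edges added outside the clique. With P, T,
    Q the sums of x over the clique, of x and of c, the clique rows add up to (l + 1) P = p T and
    the others to l (T - P) = (n - p) P + Q; eliminating T leaves the surplus times P. *)
Lemma Snh_perturbed_eigen (R : realType) (n p : nat) (x c : 'I_n -> R) (l : R) :
  (p <= n)%N -> (forall i, nbsum (Snh n p) x i + c i = l * x i) ->
  (forall i : 'I_n, (i < p)%N -> c i = 0) ->
  (l + 1) * (\sum_(i < n | (i < p)%N) x i) = p%:R * (\sum_i x i) /\
  (l ^+ 2 - (p%:R - 1) * l - p%:R * (n%:R - p%:R)) * (\sum_(i < n | (i < p)%N) x i)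
    = p%:R * \sum_i c i.
Proof.
move=> pn eigx c0.
set P := \sum_(i < n | _) x i; set T := \sum_i x i; set Q := \sum_i c i.
have HP : l * P = p%:R * T - P.
  rewrite mulr_sumr; under eq_bigr => i ip do rewrite -eigx c0 // addr0 nbsum_Snh ip.
  rewrite sumrB -/P; congr (_ - _); under eq_bigr do rewrite -[\sum_i _]mulr1.
  by rewrite -mulr_sumr sum1_ltn // mulrC.
have HT : l * T = l * P + (n%:R - p%:R) * P + Q.
  have -> : Q = \sum_(i < n | ~~ (i < p)%N) c i.
    by rewrite /Q (bigID (fun i : 'I_n => (i < p)%N)) /= big1 ?add0r.
  rewrite /T (bigID (fun i : 'I_n => (i < p)%N)) /= mulrDr -addrA; congr (_ + _).
  rewrite [LHS]mulr_sumr; under [LHS]eq_bigr => i /negbTE ip do rewrite -eigx nbsum_Snh ip -/P.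
  rewrite big_split /=; congr (_ + _); under [LHS]eq_bigr do rewrite -[P]mulr1.
  by rewrite -mulr_sumr sum1_geq // mulrC.
split; first by rewrite mulrDl HP; ring.
have : p%:R * (l * T) = l * (l * P + P) by rewrite HP; ring.
rewrite HT => H.
have -> : p%:R * Q = p%:R * (l * P + (n%:R - p%:R) * P + Q) -
  p%:R * (l * P + (n%:R - p%:R) * P) by ring.
by rewrite H; ring.
Qed.

Lemma spec_radius_Snh (R : realType) (n p : nat) :
  (0 < p < n)%N ->
  spec_radius R (Snh n p) ^+ 2 - (p%:R - 1) * spec_radius R (Snh n p)
    - p%:R * (n%:R - p%:R) = 0.
Proof.
move=> /andP[p0 pn]; have n0 : (0 < n)%N by lia.
have [x [x0 x1 eigx _]] := perron R n0 (sgraph_Snh n p).1.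
have lp := spec_radius_Snh_ge R pn.
have T0 := sum_gt0_sqnorm1 x0 x1.
set l := spec_radius R _ in eigx lp *.
have [|//|E1] := @Snh_perturbed_eigen R n p x (fun=> 0) l (ltnW pn).
  by move=> i; rewrite addr0.
(* The surplus times P is zero, and P is nonzero since (l + 1) P = p T with T > 0. *)
rewrite big1_eq mulr0 => /eqP; rewrite mulf_eq0 => /orP[/eqP //|/eqP P0].
have pp : 0 < p%:R :> R by rewrite ltr0n.
by move: E1; rewrite P0 mulr0 => /eqP; rewrite eq_sym mulf_eq0 !gt_eqF.
Qed.

(** For the ends u, v of the extra edge, Q = x_u + x_v, and adding their two rows gives (l - 1) Q =
    2 P. *)
Lemma spec_radius_Snh_plus (R : realType) (n p : nat) :
  (0 < p)%N -> (p.+2 <= n)%N ->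
  (spec_radius R (Snh_plus n p) ^+ 2 - (p%:R - 1) * spec_radius R (Snh_plus n p)
    - p%:R * (n%:R - p%:R)) * (spec_radius R (Snh_plus n p) - 1) = 2 * p%:R.
Proof.
move=> p0 pn; have n0 : (0 < n)%N by lia.
have [x [x0 x1 eigx _]] := perron R n0 (sgraph_Snh_plus n p).1.
have lp := spec_radius_Snh_plus_ge R pn.
have T0 := sum_gt0_sqnorm1 x0 x1.
set l := spec_radius R _ in eigx lp *.
pose u : 'I_n := Ordinal (ltnW pn); pose v : 'I_n := Ordinal pn.
pose c (i : 'I_n) : R := (i == u)%:R * x v + (i == v)%:R * x u.
have uv : (u == v) = false by apply/negbTE; rewrite -(inj_eq val_inj) /=; lia.
have [|i ip|E1 E2] := @Snh_perturbed_eigen R n p x c l (ltnW (ltnW pn)).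
- by move=> i; rewrite -eigx (@nbsum_Snh_plus _ _ _ _ u v).
- rewrite /c -!(inj_eq val_inj) /= !ltn_eqF ?mul0r ?addr0 //; lia.
have Ec : \sum_i c i = x u + x v.
  rewrite big_split /= -!mulr_suml.
  have pick (w : 'I_n) : \sum_i ((i == w)%:R : R) = 1.
    by rewrite (bigD1 w) //= eqxx big1 ?addr0 // => j /negbTE ->.
  by rewrite !pick; ring.
have pp : 0 < p%:R :> R by rewrite ltr0n.
set P := \sum_(i < n | _) x i in E1 E2.
have P0 : P != 0.
  apply/eqP => P0; move: E1.
  by rewrite P0 mulr0 => /eqP; rewrite eq_sym mulf_eq0 !gt_eqF.
have Eu : l * x u = P + x v.
  by rewrite -eigx (@nbsum_Snh_plus _ _ _ _ u v) // nbsum_Snh ltnn eqxx uv -/P /=; ring.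
have Ev : l * x v = P + x u.
  rewrite -eigx (@nbsum_Snh_plus _ _ _ _ u v) // nbsum_Snh eqxx (eq_sym v) uv.
  by rewrite ltnNge leqnSn -/P /=; ring.
apply: (mulIf P0); rewrite mulrAC E2 Ec.
have -> : p%:R * (x u + x v) * (l - 1) =
  p%:R * (l * x u + l * x v - (x u + x v)) by ring.
by rewrite Eu Ev; ring.
Qed.

(** * Growth of the surplus *)

(** Bernoulli's inequality cleared of denominators; the induction step loses exactly (n + 1) y^2
    x^n. *)
Lemma bernoulli_homogeneous (R : realFieldType) (x y : R) (n : nat) :
  0 <= x -> 0 <= x + y -> x ^+ n.+1 + n.+1%:R * y * x ^+ n <= (x + y) ^+ n.+1.
Proof.
move=> x0 xy0; elim: n => [|n IH]; first by rewrite !expr1 expr0 mulr1 mul1r.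
have H := ler_wpM2l xy0 IH; rewrite -exprS in H; apply: le_trans H.
rewrite -subr_ge0 (_ : _ - _ = n.+1%:R * (y ^+ 2 * x ^+ n)).
  by apply: mulr_ge0 => //; apply: mulr_ge0; rewrite ?sqr_ge0 ?exprn_ge0.
rewrite !exprS -[n.+2%:R]natr1; ring.
Qed.

Definition surplus (R : realType) (p N l : R) : R :=
  l ^+ 2 - (p - 1) * l - p * N.

Lemma surplus_ge0_lambda (R : realType) (p N l : R) :
  2 <= p -> 0 <= N -> 0 < l -> 0 <= surplus p N l ->
  p - 1 <= l /\ p * N + (p - 1) * l <= l ^+ 2.
Proof.
rewrite /surplus => p2 N0 l0 s0; have pN : 0 <= p * N by rewrite mulr_ge0; lra.
split; last by lra.
have : 0 <= l * (l - (p - 1)) by lra.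
by rewrite pmulr_rge0 // subr_ge0.
Qed.

Lemma surplus_le (R : realType) (p N l l' : R) :
  p - 1 <= l -> l <= l' -> 0 <= p - 1 -> surplus p N l <= surplus p N l'.
Proof.
rewrite /surplus => pl ll' p1.
have : 0 <= (l' - l) * (l' + l - (p - 1)) by rewrite mulr_ge0; lra.
lra.
Qed.


(* Writing D = l^2 + (p - 1) N, the surplus grows by at least
   (l^2 - (p - 1) surplus) / D when N drops by one. *)
Lemma surplus_step (R : realType) (p N l l' e : R) :
  2 <= p -> 2 <= N -> 0 < l -> 0 <= surplus p N l -> 0 <= e ->
  e * (l ^+ 2 + (p - 1) * N) <= p - 1 -> l * (1 - e) <= l' ->
  [/\ e <= 2^-1, 0 < l' &
      l ^+ 2 - (p - 1) * surplus p N l <=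
      (l ^+ 2 + (p - 1) * N) * (surplus p (N - 1) l' - surplus p N l)].
Proof.
move=> p2 N2 l0 s0 e0; set D := l ^+ 2 + _ => eD l'ge.
have N0 : 0 <= N by lra.
have [pl ll] := surplus_ge0_lambda p2 N0 l0 s0.
have D2 : 2 * (p - 1) <= D.
  have : 0 <= (p - 1) * (N - 2) by rewrite mulr_ge0; lra.
  have : 0 <= l ^+ 2 by rewrite sqr_ge0.
  rewrite /D; lra.
have e12 : e <= 2^-1.
  have D0 : 0 < D by lra.
  rewrite -(ler_pM2r D0); lra.
have a0 : l / 2 <= l * (1 - e) by rewrite ler_pM2l //; lra.
split=> //; first by lra.
set m := surplus p N l in s0 *.
(* Lower l' to l (1 - e), where the surplus is still increasing, and drop the square (l e)^2; the
   term p comes from N dropping by one. *)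
have H1 : m + p - e * (2 * l ^+ 2 - (p - 1) * l) <= surplus p (N - 1) l'.
  have : 0 <= (l' - l * (1 - e)) * (l' + l * (1 - e) - (p - 1)).
    by rewrite mulr_ge0; lra.
  have : 0 <= (l * e) ^+ 2 by rewrite sqr_ge0.
  rewrite /m /surplus; lra.
have H2 : D * (m + p - e * (2 * l ^+ 2 - (p - 1) * l)) <= D * surplus p (N - 1) l'.
  by rewrite ler_pM2l //; lra.
have H3 : 0 <= (p - 1 - e * D) * (2 * l ^+ 2 - (p - 1) * l).
  rewrite mulr_ge0 //; first lra.
  have : 0 <= l * (l - (p - 1)) by rewrite mulr_ge0; lra.
  have : 0 <= l ^+ 2 by rewrite sqr_ge0.
  lra.
rewrite (_ : _ - _ = D * p - (p - 1) * (2 * l ^+ 2 - (p - 1) * l)); last first.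
  by rewrite /m /surplus /D; ring.
lra.
Qed.

(** The lower bound for D times the new surplus increases with the old one, so the worst case is the
    value t, where D / 2 <= l^2 - (p - 1) t suffices. The descent takes t = 0, then t = 1/2. *)
Lemma surplus_gain (R : realType) (p N l l' t : R) :
  2 <= p -> 2 <= N -> 0 < l -> 0 <= t <= 2^-1 -> t <= surplus p N l ->
  l ^+ 2 - (p - 1) * surplus p N l <=
    (l ^+ 2 + (p - 1) * N) * (surplus p (N - 1) l' - surplus p N l) ->
  t + 2^-1 <= surplus p (N - 1) l'.
Proof.
move=> p2 N2 l0 /andP[t0 t12] st; set D := l ^+ 2 + _ * N.
have N0 : 0 <= N by lra.
have [pl ll] := surplus_ge0_lambda p2 N0 l0 (le_trans t0 st).
have pN : 0 <= (p - 1) * (N - 2) by rewrite mulr_ge0; lra.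
have l2 : 0 <= l ^+ 2 by rewrite sqr_ge0.
have D0 : 0 < D by rewrite /D; lra.
set m := surplus p N l in st *; set m' := surplus _ _ _ => H.
rewrite -(ler_pM2l D0).
have H1 : 0 <= (m - t) * (D - (p - 1)) by rewrite mulr_ge0 // /D; lra.
have H2 : 0 <= (p - 1) * (l - 2 * t) by rewrite mulr_ge0; lra.
suff : D / 2 <= l ^+ 2 - (p - 1) * t by lra.
rewrite /D; lra.
Qed.

(** The same monotonicity at the value 1, where p - 1 <= l^2 suffices. *)
Lemma surplus_keep (R : realType) (p N l l' : R) :
  2 <= p -> 2 <= N -> 0 < l -> 1 <= surplus p N l ->
  l ^+ 2 - (p - 1) * surplus p N l <=
    (l ^+ 2 + (p - 1) * N) * (surplus p (N - 1) l' - surplus p N l) ->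
  1 <= surplus p (N - 1) l'.
Proof.
move=> p2 N2 l0 st; set D := l ^+ 2 + _ * N.
have N0 : 0 <= N by lra.
have [pl ll] := surplus_ge0_lambda p2 N0 l0 (le_trans ler01 st).
have pN : 0 <= (p - 1) * (N - 2) by rewrite mulr_ge0; lra.
have l2 : 0 <= l ^+ 2 by rewrite sqr_ge0.
have D0 : 0 < D by rewrite /D; lra.
set m := surplus p N l in st *; set m' := surplus _ _ _ => H.
rewrite -(ler_pM2l D0).
have H1 : 0 <= (m - 1) * (D - (p - 1)) by rewrite mulr_ge0 // /D; lra.
have H2 : 0 <= (p - 1) * (l - 1) by rewrite mulr_ge0; lra.
have H3 : 0 <= p * N by rewrite mulr_ge0; lra.
suff : p - 1 <= l ^+ 2 by lra.
lra.
Qed.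

(** With y = 1 / (r + 1), one removal keeps N l'^2 >= l^2 (N - 1 + y), while Bernoulli gives (N - 1
    + y)^(r+1) >= N (N - 1)^r; take the power r + 1 of the first and multiply. *)
Lemma growth_step (R : realType) (p N l l' e C : R) (r : nat) :
  2 <= p -> 2 <= N -> 0 < l -> 0 <= surplus p N l -> 0 <= e -> e <= 2^-1 ->
  e * (l ^+ 2 + (p - 1) * N) <= p - 1 -> l * (1 - e) <= l' ->
  r.+1%:R = 2 * p - 1 -> 0 <= C ->
  C * N ^+ r <= (l ^+ 2) ^+ r.+1 -> C * (N - 1) ^+ r <= (l' ^+ 2) ^+ r.+1.
Proof.
move=> p2 N2 l0 s0 e0 e12 eD l'ge rp C0 HC.
have N0 : 0 <= N by lra.
have [pl ll] := surplus_ge0_lambda p2 N0 l0 s0.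
have r0 : 0 < r.+1%:R :> R by rewrite ltr0n.
set y : R := r.+1%:R^-1.
have y0 : 0 <= y by rewrite invr_ge0 ltW.
have ry : r.+1%:R * y = 1 by rewrite mulfV // gt_eqF.
have B := @bernoulli_homogeneous R (N - 1) y r.
have {B}B : N * (N - 1) ^+ r <= (N - 1 + y) ^+ r.+1.
  have {}B := B ltac:(lra) ltac:(lra).
  by apply: le_trans B; rewrite ry exprS -mulrDl subrK.
(* This fixes the exponent: l^2 >= p N gives e (2 p - 1) N <= p - 1, so 2 e N <= (2 p - 2) / (2 p -
   1) = 1 - y. *)
have eN : 2 * e * N <= 1 - y.
  rewrite -(ler_pM2l r0) mulrBr mulr1 ry rp.
  have : 0 <= e * (l ^+ 2 - p * N).
    have : 0 <= (p - 1) * l by rewrite mulr_ge0; lra.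
    move=> ?; rewrite mulr_ge0 //; lra.
  lra.
have l'2 : l ^+ 2 * (N - 1 + y) <= N * l' ^+ 2.
  have H1 : l ^+ 2 * (1 - e) ^+ 2 <= l' ^+ 2.
    rewrite -exprMn ler_pXn2r ?nnegrE //; last by apply: le_trans l'ge; rewrite mulr_ge0; lra.
    by rewrite mulr_ge0; lra.
  have H2 : N * (l ^+ 2 * (1 - e) ^+ 2) <= N * l' ^+ 2 by rewrite ler_wpM2l.
  apply: le_trans H2.
  have H3 : 0 <= l ^+ 2 * (1 - y - 2 * e * N) by rewrite mulr_ge0 ?sqr_ge0 //; lra.
  have H4 : 0 <= N * (l * e) ^+ 2 by rewrite mulr_ge0 // sqr_ge0.
  lra.
have Np : 0 < N ^+ r.+1 by rewrite exprn_gt0; lra.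
rewrite -(ler_pM2l Np) -[leRHS]exprMn.
have H5 : (l ^+ 2 * (N - 1 + y)) ^+ r.+1 <= (N * l' ^+ 2) ^+ r.+1.
  rewrite ler_pXn2r ?nnegrE //.
    by rewrite mulr_ge0 ?sqr_ge0 //; lra.
  by rewrite mulr_ge0 ?sqr_ge0.
apply: le_trans H5; rewrite exprMn.
have -> : N ^+ r.+1 * (C * (N - 1) ^+ r) = (C * N ^+ r) * (N * (N - 1) ^+ r).
  by rewrite exprS; ring.
apply: ler_pM => //; first by rewrite mulr_ge0 // exprn_ge0.
by rewrite mulr_ge0 // exprn_ge0; lra.
Qed.

(** * Descent *)

Lemma four_sqr_le_pow (p : nat) : (2 <= p)%N -> (4 * p ^ 2 <= 2 ^ (2 * p))%N.
Proof.
elim: p => // p IH; rewrite leq_eqVlt => /orP[/eqP [<-] //|].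
rewrite ltnS => p2; have {}IH := IH p2.
by rewrite mulnS expnD; apply: leq_trans (leq_mul (leqnn 4) IH); nia.
Qed.

Lemma pow_le_of_sqr (p n h : nat) :
  (2 ^ (4 * p) <= n)%N -> (n <= h ^ 2)%N -> (2 ^ (2 * p) <= h)%N.
Proof.
move=> pn nh; rewrite -(@leq_exp2r _ _ 2) // -expnM mulnAC.
exact: leq_trans pn nh.
Qed.

(** The clash at h, the square root of n rounded up, with L in the role of l^2: the arc bound gives
    L <= 2 p (h - p / 2), too small for the growth bound. *)
Lemma descent_arithmetic (R : realType) (p h n r : nat) (L : R) :
  (2 <= p)%N -> (2 ^ (4 * p) <= n)%N -> (n <= h ^ 2)%N -> (h.-1 ^ 2 < n)%N ->
  r.+1 = (2 * p - 1)%N -> 0 <= L ->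
  L <= 2 * p%:R * h%:R - p%:R * (p%:R + 1) + 2 ->
  p%:R ^+ r.+1 * (n%:R - p%:R) * (h%:R - p%:R) ^+ r <= L ^+ r.+1 -> False.
Proof.
move=> p2 pn nh hn rp L0 Lh HL.
have hp := pow_le_of_sqr pn nh.
have h4 := leq_trans (four_sqr_le_pow p2) hp.
have p2R : 2 <= p%:R :> R by rewrite ler_nat.
have h4R : 4 * p%:R ^+ 2 <= h%:R :> R by rewrite -natrX -natrM ler_nat.
have rR : r.+1%:R = 2 * p%:R - 1 :> R.
  by rewrite rp natrB ?natrM //; lia.
have powR : 2 * 2 ^+ r.+1 <= h%:R :> R.
  rewrite -exprS rp (_ : (2 * p - 1).+1 = 2 * p)%N; last by lia.
  by rewrite -natrX ler_nat.
have nR : (h%:R - 1) ^+ 2 + 1 <= n%:R :> R.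
  have h0 : (0 < h)%N by lia.
  rewrite -(natrB _ h0) -natrX natr1 ler_nat; rewrite subn1; exact: hn.
set P : R := p%:R in HL Lh p2R h4R rR *.
set H : R := h%:R in HL Lh h4R powR nR *.
set n' : R := n%:R in HL nR *.
have PP : 2 * P <= P ^+ 2 by rewrite expr2 ler_wpM2r //; lra.
pose M := H - P / 2.
have M0 : 0 < M by rewrite /M; lra.
have LM : L <= 2 * P * M by rewrite /M; lra.
have LM' : L ^+ r.+1 <= (2 * P * M) ^+ r.+1.
  by rewrite ler_pXn2r ?nnegrE //; lra.
have Pr : 0 < P ^+ r.+1 by rewrite exprn_gt0 //; lra.
have H1 : (n' - P) * (H - P) ^+ r <= 2 ^+ r.+1 * M ^+ r.+1.
  rewrite -(ler_pM2l Pr) mulrA (le_trans HL) // (le_trans LM') //.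
  by rewrite !exprMn mulrA [P ^+ _ * _]mulrC.
(* Since H - P = M - P / 2 and H >= 4 P^2, Bernoulli makes (H - P)^(r+1) at least 3/4 of M^(r+1). *)
have B := @bernoulli_homogeneous R M (- (P / 2)) r (ltW M0).
have {B} : M ^+ r * (M - r.+1%:R * (P / 2)) <= (H - P) ^+ r.+1.
  have {}B := B ltac:(rewrite /M; lra).
  rewrite (_ : H - P = M + - (P / 2)); last by rewrite /M; lra.
  by apply: le_trans B; rewrite exprS mulrN; lra.
rewrite rR => B.
have H2 : (n' - P) * (H - P) ^+ r.+1 <= 2 ^+ r.+1 * M ^+ r.+1 * (H - P).
  by rewrite [_ ^+ r.+1]exprS mulrCA mulrC ler_wpM2r //; lra.
have HH : 0 <= H * (H - 16) by rewrite mulr_ge0 //; lra.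
have nP : 0 <= n' - P by lra.
have H3 : (n' - P) * (M ^+ r * (M * (3 / 4))) <= 2 ^+ r.+1 * M ^+ r.+1 * (H - P).
  apply: le_trans H2; rewrite ler_wpM2l //; apply: le_trans B.
  rewrite ler_wpM2l ?exprn_ge0 ?(ltW M0) //.
  rewrite /M; lra.
have H4 : (n' - P) * (3 / 4) <= 2 ^+ r.+1 * (H - P).
  have Mr : 0 < M ^+ r.+1 by rewrite exprn_gt0.
  rewrite -(ler_pM2l Mr) (le_trans _ (le_trans H3 _)) //.
    by rewrite exprS; lra.
  by rewrite mulrAC mulrC.
(* Here 2^(2p) <= h turns the estimate into 3 (n - p) <= 2 h (h - p), which fails for n > (h - 1)^2
   and h >= 16. *)
have H5 : 0 <= (H - 2 * 2 ^+ r.+1) * (H - P) by rewrite mulr_ge0 //; lra.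
have H6 : 0 <= P * (H - 2) by rewrite mulr_ge0 //; lra.
move: H4 H5; move: (2 ^+ r.+1) => K H4 H5.
have {H4 H5}H7 : 3 * (n' - P) <= 2 * (H * (H - P)) by lra.
clear -p2R h4R nR PP HH H6 H7; lra.
Qed.

Lemma vdel_step (R : realType) (h p k r : nat) (F : rel 'I_k) (G : rel 'I_h.+1)
    (C : R) v :
  (2 <= p)%N -> (p < h)%N -> sgraph G -> Ffree G F -> 0 < spec_radius R G ->
  0 <= surplus p%:R (h.+1%:R - p%:R) (spec_radius R G) ->
  (degree G v < p)%N -> r.+1 = (2 * p - 1)%N -> 0 <= C ->
  C * (h.+1%:R - p%:R) ^+ r <= (spec_radius R G ^+ 2) ^+ r.+1 ->
  exists H : rel 'I_h, [/\ sgraph H, Ffree H F, 0 < spec_radius R H,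
    C * (h%:R - p%:R) ^+ r <= (spec_radius R H ^+ 2) ^+ r.+1 &
    (forall t : R, 0 <= t <= 2^-1 ->
       t <= surplus p%:R (h.+1%:R - p%:R) (spec_radius R G) ->
       t + 2^-1 <= surplus p%:R (h%:R - p%:R) (spec_radius R H)) /\
    (1 <= surplus p%:R (h.+1%:R - p%:R) (spec_radius R G) ->
     1 <= surplus p%:R (h%:R - p%:R) (spec_radius R H))].
Proof.
move=> p2 ph sG GF l0 s0 dv rp C0 HC.
have p2R : 2 <= p%:R :> R by rewrite ler_nat.
have N2 : 2 <= h.+1%:R - p%:R :> R.
  by rewrite lerBrDr -natrD ler_nat; lia.
have rR : r.+1%:R = 2 * p%:R - 1 :> R.
  by rewrite rp natrB ?natrM //; lia.
have [|||u [e [e0 eD l'ge]]] := @low_degree_deletion R h p G v _ _ sG dv _; [lia..|].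
have [e12 l'0 Hs] := surplus_step p2R N2 l0 s0 e0 eD l'ge.
have EN : h.+1%:R - p%:R - 1 = h%:R - p%:R :> R by rewrite -natr1; ring.
exists (vdel G u); split=> //; [exact: sgraph_vdel|exact: Ffree_vdel| |].
- rewrite -EN; exact: (growth_step p2R N2 l0 s0 e0 e12 eD l'ge rR C0 HC).
- rewrite -EN; split=> [t t01 ts|s1].
    exact: (surplus_gain p2R N2 l0 t01 ts Hs).
  exact: (surplus_keep p2R N2 l0 s1 Hs).
Qed.

(** The subtracted term is 2 e(S_{n,p}). *)
Lemma surplus_le_narcs (R : realType) (n p : nat) (G : rel 'I_n) :
  (0 < n)%N -> sgraph G -> (forall i, (p <= degree G i)%N) ->
  surplus p%:R (n%:R - p%:R) (spec_radius R G)
    <= (narcs G)%:R - (2 * p%:R * n%:R - p%:R * (p%:R + 1)).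
Proof.
move=> n0 sG dG; have := spec_radius_min_degree R n0 sG dG.
by rewrite /surplus; lra.
Qed.

(** The first hypothesis bounds the arcs of each smaller graph, with slack 2 to cover S^+; the
    second lets removals continue while the surplus meets its threshold. A vertex of degree below p
    in G would start a descent ending in [descent_arithmetic]. *)
Lemma min_degree_descent (R : realType) (n p k : nat) (F : rel 'I_k)
    (G : rel 'I_n) :
  (2 <= p)%N -> (2 ^ (4 * p) <= n)%N ->
  (forall h, (h < n)%N -> (n <= h ^ 2)%N -> forall H : rel 'I_h,
     sgraph H -> Ffree H F ->
     (narcs H)%:R <= 2 * p%:R * h%:R - p%:R * (p%:R + 1) + 2 :> R) ->
  (forall h, (h < n)%N -> (n <= h ^ 2)%N -> forall H : rel 'I_h,
     sgraph H -> Ffree H F -> 0 < spec_radius R H ->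
     (if h.+1 == n then 2^-1 else 1)
       <= surplus p%:R (h%:R - p%:R) (spec_radius R H) ->
     exists v, (degree H v < p)%N) ->
  sgraph G -> Ffree G F -> 0 < spec_radius R G ->
  0 <= surplus p%:R (n%:R - p%:R) (spec_radius R G) ->
  forall v, (p <= degree G v)%N.
Proof.
move=> p2 pn arcs_le low sG GF l0 s0 v; rewrite leqNgt; apply/negP => dv.
have p2R : 2 <= p%:R :> R by rewrite ler_nat.
pose r := (2 * p - 2)%N; have rp : r.+1 = (2 * p - 1)%N by rewrite /r; lia.
have big h : (n <= h ^ 2)%N -> (p < h)%N.
  move=> nh; have := leq_trans (four_sqr_le_pow p2) (pow_le_of_sqr pn nh); nia.
have p2n : (p < n)%N.
  apply: leq_trans pn; apply: leq_trans (ltn_expl p (ltnSn 1)) _.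
  by rewrite leq_exp2l //; lia.
have nR : 0 <= n%:R - p%:R :> R by rewrite subr_ge0 ler_nat ltnW.
(* Chosen so that C N^r = (p N)^(r+1) at order n, where l^2 >= p N. *)
pose C : R := p%:R ^+ r.+1 * (n%:R - p%:R).
have C0 : 0 <= C by rewrite mulr_ge0 // exprn_ge0.
have HC : C * (n%:R - p%:R) ^+ r <= (spec_radius R G ^+ 2) ^+ r.+1.
  rewrite /C -mulrA -exprS -exprMn ler_pXn2r ?nnegrE ?sqr_ge0 ?mulr_ge0 //.
  have [] := surplus_ge0_lambda p2R nR l0 s0.
  have : 0 <= (p%:R - 1) * spec_radius R G by rewrite mulr_ge0; lra.
  lra.
(* The graph of order h arises after j + 1 removals; the first reaches surplus 1/2, the second 1,
   and later ones keep it. *)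
have chain j h : (h + j.+1 = n)%N -> (n <= h ^ 2)%N -> exists H : rel 'I_h,
    [/\ sgraph H, Ffree H F, 0 < spec_radius R H,
      C * (h%:R - p%:R) ^+ r <= (spec_radius R H ^+ 2) ^+ r.+1 &
      (if h.+1 == n then 2^-1 else 1)
        <= surplus p%:R (h%:R - p%:R) (spec_radius R H)].
  elim: j h => [|j IH] h hj nh.
    have nE : h.+1 = n by lia.
    clear hj arcs_le low; subst n.
    have [H [sH HF lH HCH [Hg _]]] := vdel_step p2 (big h nh) sG GF l0 s0 dv rp C0 HC.
    exists H; split=> //; rewrite eqxx -[2^-1]add0r; apply: Hg => //.
    by rewrite lexx /=; lra.
  have hj' : (h.+1 + j.+1 = n)%N by clear -hj; lia.
  have nh' : (n <= h.+1 ^ 2)%N by apply: leq_trans nh _; rewrite leq_exp2r.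
  have hn' : (h.+1 < n)%N by clear -hj; lia.
  have [H' [sH' HF' l' HC' s']] := IH h.+1 hj' nh'.
  have [v' dv'] := low h.+1 hn' nh' H' sH' HF' l' s'.
  have s'0 : 0 <= surplus p%:R (h.+1%:R - p%:R) (spec_radius R H').
    by apply: le_trans s'; case: ifP => _; lra.
  have [H [sH HF lH HCH [Hg Hk]]] :=
    vdel_step p2 (big h nh) sH' HF' l' s'0 dv' rp C0 HC'.
  have neq : (h.+1 == n) = false by clear -hj; apply/negbTE; lia.
  exists H; split=> //; rewrite neq.
  move: s'; case: ifP => _ s'; last exact: Hk.
  by apply: le_trans (Hg _ _ s'); rewrite ?lexx ?andbT; lra.
(* The descent stops at the least h with n <= h^2. *)
have ex_h : exists h, (n <= h ^ 2)%N by exists n; rewrite expnS expn1 leq_pmulr //; lia.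
pose h := ex_minn ex_h.
have [nh hmin] : (n <= h ^ 2)%N /\ (h.-1 ^ 2 < n)%N.
  rewrite /h; case: ex_minnP => h0 nh0 min0; split=> //.
  rewrite ltnNge; apply/negP => /min0; have := big h0 nh0; clear; lia.
have n4 : (16 <= n)%N.
  apply: leq_trans pn; rewrite (_ : 16 = 2 ^ 4)%N // leq_exp2l //; lia.
have hn : (h < n)%N.
  have h3 := big h nh; have h2 : (2 <= h.-1)%N by lia.
  by have := leq_mul h2 (leqnn h.-1); rewrite mulnn; lia.
have [|//|H [sH HF lH HCH _]] := chain (n - h).-1 h; first by lia.
have := arcs_le h hn nh H sH HF.
have h0 : (0 < h)%N by have := big h nh; lia.
move=> /(le_trans (sqr_spec_radius_le R h0 sH.1)) Hle.
exact: (descent_arithmetic p2 pn nh hmin rp (sqr_ge0 _) Hle HCH).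
Qed.

(** * From edge-extremal to spectrally extremal graphs *)

Lemma in_Exsp_giso (R : realType) (n k : nat) (F : rel 'I_k) (S : rel 'I_n) :
  (0 < n)%N -> sgraph S -> Ffree S F ->
  (forall H : rel 'I_n, sgraph H -> Ffree H F ->
     spec_radius R S <= spec_radius R H -> giso H S) ->
  forall G : rel 'I_n, sgraph G -> (in_Exsp R F G <-> giso G S).
Proof.
move=> n0 sS SF uniqS G sG; split=> [[_ [GF maxG]]|GS].
  by apply: uniqS => //; exact: maxG.
split=> //; split.
  case: GS => s Gs [f [finj fG]]; apply: SF; exists (s \o f); split.
    by apply: inj_comp finj; exact: perm_inj.
  by move=> u v /fG; rewrite Gs.
(* A graph of larger radius would be isomorphic to [S], hence of equal radius. *)
move=> H sH HF; rewrite (spec_radius_giso R n0 sS GS) leNgt; apply/negP => lt.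
by move: (lt); rewrite (spec_radius_giso R n0 sS (uniqS H sH HF (ltW lt))) ltxx.
Qed.

Lemma in_Ex_narcs (n k : nat) (F : rel 'I_k) (G H : rel 'I_n) :
  in_Ex F G -> sgraph H -> Ffree H F -> (narcs H <= narcs G)%N.
Proof.
move=> [sG [_ maxG]] sH HF; rewrite -!double_nedges // leq_pmul2l //.
exact: maxG.
Qed.

Lemma narcs_in_Ex (n k : nat) (F : rel 'I_k) (G H : rel 'I_n) :
  in_Ex F G -> sgraph H -> Ffree H F -> (narcs G <= narcs H)%N -> in_Ex F H.
Proof.
move=> [sG [_ maxG]] sH HF; rewrite -!double_nedges // leq_pmul2l // => GH.
by split=> //; split=> // K sK KF; apply: leq_trans GH; exact: maxG.
Qed.

(** Both numbers of arcs are even. *)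
Lemma narcs_lt_add2 (n : nat) (G H : rel 'I_n) :
  sgraph G -> sgraph H -> (narcs G < narcs H)%N -> (narcs G + 2 <= narcs H)%N.
Proof. by move=> /double_nedges <- /double_nedges <-; lia. Qed.


(** Here m^2 <= n enters: every order h met in the descent is at least m, so edge-extremality is
    known there. *)
Lemma order_bounds (p m n h : nat) :
  (2 <= p)%N -> (maxn (2 ^ (4 * p)) (m ^ 2) <= n)%N -> (n <= h ^ 2)%N ->
  (m <= h)%N /\ (4 * p ^ 2 <= h)%N.
Proof.
rewrite geq_max => p2 /andP[pn mn] nh; split.
  by rewrite -(@leq_exp2r _ _ 2) //; exact: leq_trans mn nh.
exact: leq_trans (four_sqr_le_pow p2) (pow_le_of_sqr pn nh).
Qed.

Lemma surplus_Snh (R : realType) (n p : nat) (l : R) :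
  (2 <= p)%N -> (p < n)%N -> spec_radius R (Snh n p) <= l ->
  0 <= surplus p%:R (n%:R - p%:R) l.
Proof.
move=> p2 pn ll; have lp := spec_radius_Snh_ge R pn.
have p2R : 2 <= p%:R :> R by rewrite ler_nat.
rewrite -(@spec_radius_Snh R n p) ?pn ?andbT; last by lia.
by apply: surplus_le ll _; lra.
Qed.

Lemma surplus_Snh_plus (R : realType) (n p : nat) (l : R) :
  (2 <= p)%N -> (p.+2 <= n)%N -> spec_radius R (Snh_plus n p) <= l ->
  0 < surplus p%:R (n%:R - p%:R) l.
Proof.
move=> p2 pn ll; have lp := spec_radius_Snh_plus_ge R pn.
have p2R : 2 <= p%:R :> R by rewrite ler_nat.
have p0 : (0 < p)%N by lia.
have E := spec_radius_Snh_plus R p0 pn.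
have l1 : 0 < spec_radius R (Snh_plus n p) - 1 by lra.
have sp : 0 < surplus p%:R (n%:R - p%:R) (spec_radius R (Snh_plus n p)).
  by rewrite -(pmulr_lgt0 _ l1) /surplus E; lra.
by apply: (lt_le_trans sp); apply: surplus_le ll _; lra.
Qed.

(* The surplus 2p / (l - 1) of S^+_{h,p} is smaller than what the descent has
   gained. *)
Lemma surplus_Snh_plus_lt (R : realType) (n p h : nat) :
  (2 <= p)%N -> (2 ^ (4 * p) <= n)%N -> (4 * p ^ 2 <= h)%N ->
  surplus p%:R (h%:R - p%:R) (spec_radius R (Snh_plus h p))
    < (if h.+1 == n then 2^-1 else 1).
Proof.
move=> p2 pn ph; rewrite ltNge; apply/negP => s.
have p2h : (p.+2 <= h)%N by nia.
have p0 : (0 < p)%N by lia.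
have lp := spec_radius_Snh_plus_ge R p2h.
have := spec_radius_Snh_plus R p0 p2h.
rewrite -[_ - _ * (_ - _)]/(surplus _ _ _).
set l := spec_radius R _ in s lp *; set c := surplus _ _ _ in s * => E.
have p2R : 2 <= p%:R :> R by rewrite ler_nat.
have phR : 4 * p%:R ^+ 2 <= h%:R :> R by rewrite -natrX -natrM ler_nat.
have Ec : l ^+ 2 - (p%:R - 1) * l - p%:R * (h%:R - p%:R) = c by [].
have PP : 0 <= p%:R * (p%:R - 2) :> R by rewrite mulr_ge0 //; lra.
have PPP : 0 <= p%:R ^+ 2 * (p%:R - 2) :> R by rewrite mulr_ge0 ?sqr_ge0 //; lra.
have Ph : 0 <= p%:R * (h%:R - 4 * p%:R ^+ 2) :> R by rewrite mulr_ge0 // subr_ge0.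
move: s; case: ifP => [/eqP hn|_] s.
  (* After a single removal the threshold 1/2 only gives l <= 4 p + 1, but then h = n - 1 is large
     enough; otherwise l <= 2 p + 1 and h >= 4 p^2 suffices. *)
  have hR : 32 * p%:R ^+ 2 <= h%:R :> R.
    rewrite -natrX -natrM ler_nat.
    have := four_sqr_le_pow p2.
    have : (2 ^ (4 * p) = 2 ^ (2 * p) * 2 ^ (2 * p))%N by rewrite -expnD; congr expn; lia.
    move: pn; rewrite -hn; move: (2 ^ (4 * p))%N (2 ^ (2 * p))%N => a b.
    move=> ab aE b4; have x4 : (2 ^ 2 <= p ^ 2)%N by rewrite leq_exp2r.
    move: (p ^ 2)%N x4 b4 ab (leq_mul b4 b4) => x x4 b4 ab bb.
    by clear -x4 ab aE bb; nia.
  have l4 : l <= 4 * p%:R + 1.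
    have : 0 <= (c - 2^-1) * (l - 1) by rewrite mulr_ge0; lra.
    lra.
  have : 0 <= (4 * p%:R + 1 - l) * (4 * p%:R + 1 + l - (p%:R - 1)).
    by rewrite mulr_ge0; lra.
  have : 0 <= p%:R * (h%:R - 32 * p%:R ^+ 2) :> R by rewrite mulr_ge0 // subr_ge0.
  lra.
have l2 : l <= 2 * p%:R + 1.
  have : 0 <= (c - 1) * (l - 1) by rewrite mulr_ge0; lra.
  lra.
have : 0 <= (2 * p%:R + 1 - l) * (2 * p%:R + 1 + l - (p%:R - 1)).
  by rewrite mulr_ge0; lra.
lra.
Qed.

(** A graph of order h stopping the descent would have surplus at least 1/2 but no more arcs than
    S_{h,p}. So H has minimum degree at least p, and its nonnegative surplus gives it as many arcs
    as S_{n,p}. *)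
Lemma Exsp_Snh (R : realType) (k : nat) (F : rel 'I_k) (p m n : nat) :
  (2 <= p)%N ->
  (forall n, (m <= n)%N -> forall G : rel 'I_n, sgraph G ->
     (in_Ex F G <-> giso G (Snh n p))) ->
  (maxn (2 ^ (4 * p)) (m ^ 2) <= n)%N -> forall G : rel 'I_n, sgraph G ->
  (in_Exsp R F G <-> giso G (Snh n p)).
Proof.
move=> p2 ExS n_ge.
have pn : (2 ^ (4 * p) <= n)%N by move: n_ge; rewrite geq_max => /andP[].
have order := order_bounds p2 n_ge.
have [mn p4n] : (m <= n)%N /\ (4 * p ^ 2 <= n)%N by apply: order; nia.
have SEx h : (m <= h)%N -> in_Ex F (Snh h p).
  by move=> mh; apply/ExS => //; [exact: sgraph_Snh|exact: giso_refl].
have n0 : (0 < n)%N by nia.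
apply: (in_Exsp_giso n0 (sgraph_Snh n p) (SEx n mn).2.1) => H sH HF SH.
have p2R : 2 <= p%:R :> R by rewrite ler_nat.
have pltn : (p < n)%N by nia.
have l0 : 0 < spec_radius R H.
  by have := spec_radius_Snh_ge R pltn; lra.
have s0 := surplus_Snh p2 pltn SH.
have Hdeg : forall v, (p <= degree H v)%N.
  move=> v; apply: (min_degree_descent p2 pn _ _ sH HF l0 s0 v) => h hn nh K sK KF.
    have [mh p4h] := order h nh.
    have ph : (p <= h)%N by nia.
    have := in_Ex_narcs (SEx h mh) sK KF.
    by rewrite -(ler_nat R) (narcs_Snh R ph); lra.
  move=> lK sK'; have [mh p4h] := order h nh.
  have h0 : (0 < h)%N by nia.
  have ph : (p <= h)%N by nia.
  apply/existsP; rewrite -[X in is_true X]negbK negb_exists.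
  apply/negP => /forallP dK; have {}dK w : (p <= degree K w)%N.
    by rewrite leqNgt; exact: dK.
  have := surplus_le_narcs R h0 sK dK; rewrite -(narcs_Snh R ph).
  have := in_Ex_narcs (SEx h mh) sK KF; rewrite -(ler_nat R).
  by move: sK'; case: ifP => _; lra.
apply/ExS => //; apply: (narcs_in_Ex (SEx n mn) sH HF).
have := surplus_le_narcs R n0 sH Hdeg.
by rewrite -(narcs_Snh R (ltnW pltn)) -(ler_nat R); lra.
Qed.

(** A graph stopping the descent would be S^+_{h,p} itself, whose surplus is below the threshold. *)
Lemma Exsp_Snh_plus (R : realType) (k : nat) (F : rel 'I_k) (p m n : nat) :
  (2 <= p)%N ->
  (forall n, (m <= n)%N -> forall G : rel 'I_n, sgraph G ->
     (in_Ex F G <-> giso G (Snh_plus n p))) ->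
  (maxn (2 ^ (4 * p)) (m ^ 2) <= n)%N -> forall G : rel 'I_n, sgraph G ->
  (in_Exsp R F G <-> giso G (Snh_plus n p)).
Proof.
move=> p2 ExS n_ge.
have pn : (2 ^ (4 * p) <= n)%N by move: n_ge; rewrite geq_max => /andP[].
have order := order_bounds p2 n_ge.
have [mn p4n] : (m <= n)%N /\ (4 * p ^ 2 <= n)%N by apply: order; nia.
have SEx h : (m <= h)%N -> in_Ex F (Snh_plus h p).
  by move=> mh; apply/ExS => //; [exact: sgraph_Snh_plus|exact: giso_refl].
have n0 : (0 < n)%N by nia.
apply: (in_Exsp_giso n0 (sgraph_Snh_plus n p) (SEx n mn).2.1) => H sH HF SH.
have p2R : 2 <= p%:R :> R by rewrite ler_nat.
have pltn : (p.+2 <= n)%N by nia.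
have l0 : 0 < spec_radius R H.
  by have := spec_radius_Snh_plus_ge R pltn; lra.
have s0 := surplus_Snh_plus p2 pltn SH.
(* Positive surplus means more arcs than S_{h,p}, hence by parity at least two more, as many as
   S^+_{h,p}. Used at the stopping orders and at n itself. *)
have extremal h (K : rel 'I_h) : (m <= h)%N -> (p.+2 <= h)%N -> sgraph K ->
    Ffree K F -> (forall v, (p <= degree K v)%N) ->
    0 < surplus p%:R (h%:R - p%:R) (spec_radius R K) -> giso K (Snh_plus h p).
  move=> mh ph sK KF dK sK'.
  apply/ExS => //; apply: (narcs_in_Ex (SEx h mh) sK KF).
  have h0 : (0 < h)%N by lia.
  have := surplus_le_narcs R h0 sK dK.
  rewrite -(narcs_Snh R (ltnW (ltnW ph))) => H1.
  rewrite -(ler_nat R) narcs_Snh_plus // -natrD ler_nat.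
  by apply: narcs_lt_add2 => //; [exact: sgraph_Snh|rewrite -(ltr_nat R); lra].
have Hdeg : forall v, (p <= degree H v)%N.
  move=> v; apply: (min_degree_descent p2 pn _ _ sH HF l0 (ltW s0) v) => h hn nh K sK KF.
    have [mh p4h] := order h nh.
    have ph : (p.+2 <= h)%N by nia.
    have := in_Ex_narcs (SEx h mh) sK KF.
    rewrite -(ler_nat R) (narcs_Snh_plus R ph) (narcs_Snh R (ltnW (ltnW ph))).
    by lra.
  move=> lK sK'; have [mh p4h] := order h nh.
  have h0 : (0 < h)%N by nia.
  have ph : (p.+2 <= h)%N by nia.
  apply/existsP; rewrite -[X in is_true X]negbK negb_exists.
  apply/negP => /forallP dK; have {}dK w : (p <= degree K w)%N.
    by rewrite leqNgt; exact: dK.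
  have sK0 : 0 < surplus p%:R (h%:R - p%:R) (spec_radius R K).
    by apply: lt_le_trans sK'; case: ifP => _; lra.
  have isoK := extremal h K mh ph sK KF dK sK0.
  move: sK'; rewrite (spec_radius_giso R h0 (sgraph_Snh_plus h p) isoK) leNgt.
  by rewrite surplus_Snh_plus_lt.
exact: extremal.
Qed.

Local Close Scope ring_scope.

Theorem theorem1p7 (R : realType) (k : nat) (F : rel 'I_k) (p m : nat) :
  sgraph F -> 2 <= p -> 0 < m ->
  ((forall n, m <= n -> forall G : rel 'I_n, sgraph G ->
        (in_Ex F G <-> giso G (Snh n p))) ->
     forall n, maxn (2 ^ (4 * p)) (m ^ 2) <= n -> forall G : rel 'I_n, sgraph G ->
        (in_Exsp R F G <-> giso G (Snh n p)))
  /\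
  ((forall n, m <= n -> forall G : rel 'I_n, sgraph G ->
        (in_Ex F G <-> giso G (Snh_plus n p))) ->
     forall n, maxn (2 ^ (4 * p)) (m ^ 2) <= n -> forall G : rel 'I_n, sgraph G ->
        (in_Exsp R F G <-> giso G (Snh_plus n p))).
Proof.
move=> _ p2 _; split=> ExS n n_ge.
  exact: Exsp_Snh p2 ExS n_ge.
exact: Exsp_Snh_plus p2 ExS n_ge.
Qed.
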